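(* Let $\gamma(t)=\psi(u(t),v(t))$ be a smooth regular curve in $\mathbb{H}^2(r)$. Then $\gamma$ is an extrinsic catenary if, and only if, its curvature $\kappa$ in $\mathbb{H}^2(r)$ satisfies: (1) for the elliptic type (curve with $u>0$): $$\kappa=\frac{\dot v\cosh^2\frac{u}{r}}{r\sinh\frac{u}{r}\,\|\dot\gamma\|};$$ (2) for the hyperbolic type: $$\kappa=\frac{1}{r\|\dot\gamma\|}\left(-\frac{\dot u\sinh\frac{v}{r}}{\cosh\frac{u}{r}\cosh\frac{v}{r}}+\dot v\sinh\frac{u}{r}\right);$$ (3) for the parabolic type: $$\kappa=\frac{1}{r\|\dot\gamma\|}\left(\frac{\dot u}{\cosh\frac{u}{r}}+\dot v\sinh\frac{u}{r}\right).$$ That is, for each of the three types, $\gamma$ is an extrinsic catenary of that type if and only if the corresponding equation holds along $\gamma$.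
   Context: $r>0$; $\mathbb{E}_1^3$ is $\mathbb{R}^3$ with $\langle X,Y\rangle_1=-X_0Y_0+X_1Y_1+X_2Y_2$, and $\mathbb{H}^2(r)=\{(x,y,z)\in\mathbb{E}_1^3:-x^2+y^2+z^2=-r^2,\ x>0\}$ with the induced metric. The parametrization $$\psi(u,v)=r\left(\cosh\tfrac{u}{r}\cosh\tfrac{v}{r},\ \cosh\tfrac{u}{r}\sinh\tfrac{v}{r},\ \sinh\tfrac{u}{r}\right),\quad (u,v)\in\mathbb{R}^2,$$ gives the metric $ds^2=du^2+\cosh^2\frac{u}{r}\,dv^2$, so $\|\dot\gamma\|=\sqrt{\dot u^2+\dot v^2\cosh^2\frac{u}{r}}$. Curvature sign convention: with $\mathbf{n}=\frac{1}{\|\dot\gamma\|}\left(-\dot v\cosh\frac{u}{r}\,\partial_u+\frac{\dot u}{\cosh\frac{u}{r}}\,\partial_v\right)$ and $\nabla$ the Levi-Civita connection of $\mathbb{H}^2(r)$, $\kappa=-\langle\nabla_{\dot\gamma}\dot\gamma,\mathbf{n}\rangle/\|\dot\gamma\|^2$. Extrinsic catenaries: embed $\mathbb{H}^2(r)$ in $\mathbb{E}_1^4$ by $(x,y,z)\mapsto(x,y,z,0)$. An extrinsic catenary is a critical point (on each compact subinterval $[a,b]$, among smooth variations with fixed endpoints) of $\int_a^b\mathrm{dist}(\gamma(t),P^2)\|\dot\gamma(t)\|\,dt$, where $\mathrm{dist}$ is the distance in $\mathbb{E}_1^4$ to the plane $P^2$. The type is elliptic for $P^2=\mathrm{span}\{\mathbf{e}_x,\mathbf{e}_y\}$,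 hyperbolic for $P^2=\mathrm{span}\{\mathbf{e}_y,\mathbf{e}_z\}$, parabolic for $P^2=\mathrm{span}\{\mathbf{e}_x+\mathbf{e}_y,\mathbf{e}_z\}$. Up to positive constants the distance is, respectively, $\sinh\frac{u}{r}$, $\cosh\frac{u}{r}\cosh\frac{v}{r}$, and $e^{-v/r}\cosh\frac{u}{r}$; hence extrinsic catenaries of elliptic, hyperbolic, and parabolic type are the critical points of $$\int_a^b\sinh\tfrac{u}{r}\,\|\dot\gamma\|\,dt,\qquad \int_a^b\cosh\tfrac{u}{r}\cosh\tfrac{v}{r}\,\|\dot\gamma\|\,dt,\qquad \int_a^b e^{-v/r}\cosh\tfrac{u}{r}\,\|\dot\gamma\|\,dt.$$ Standing assumption: the curve lies on one side of $P^2$, so that the integrand is positive; for the elliptic type this is $u>0$, for the other two it is automatic. *)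

(* Defs.v *)
From Stdlib Require Import Reals Lra.
From Coquelicot Require Import Coquelicot.
Open Scope R_scope.

Definition E3 : Type := (R * R * R)%type.
Definition E4 : Type := (R * R * R * R)%type.

Definition lor3 (p q : E3) : R :=
  let '(x, y, z) := p in let '(x', y', z') := q in
  - (x * x') + y * y' + z * z'.

Definition lor4 (p q : E4) : R :=
  let '(x, y, z, w) := p in let '(x', y', z', w') := q in
  - (x * x') + y * y' + z * z' + w * w'.

Definition emb (p : E3) : E4 := (p, 0).

Definition H2 (r : R) (p : E3) : Prop :=
  lor3 p p = - r ^ 2 /\ 0 < fst (fst p).

Definition psi (r u v : R) : E3 :=
  (r * (cosh (u / r) * cosh (v / r)),
   r * (cosh (u / r) * sinh (v / r)),
   r * sinh (u / r)).

Inductive coord : Set := cu | cv.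

Definition sumc (f : coord -> R) : R := f cu + f cv.

Definition pd (i : coord) (f : R -> R -> R) (u v : R) : R :=
  match i with
  | cu => Derive (fun x => f x v) u
  | cv => Derive (fun y => f u y) v
  end.

Definition dpsi (r : R) (i : coord) (u v : R) : E3 :=
  (pd i (fun x y => fst (fst (psi r x y))) u v,
   pd i (fun x y => snd (fst (psi r x y))) u v,
   pd i (fun x y => snd (psi r x y)) u v).

Definition g (r : R) (i j : coord) (u v : R) : R :=
  lor3 (dpsi r i u v) (dpsi r j u v).

Definition detg (r u v : R) : R :=
  g r cu cu u v * g r cv cv u v - g r cu cv u v * g r cv cu u v.

Definition ginv (r : R) (i j : coord) (u v : R) : R :=
  match i, j with
  | cu, cu => g r cv cv u v
  | cu, cv => - g r cu cv u v
  | cv, cu => - g r cv cu u v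
  | cv, cv => g r cu cu u v
  end / detg r u v.

(* [k] is the upper index. *)
Definition christoffel (r : R) (k i j : coord) (u v : R) : R :=
  / 2 * sumc (fun l => ginv r k l u v *
    (pd i (g r j l) u v + pd j (g r i l) u v - pd l (g r i j) u v)).

Definition crv (u v : R -> R) (i : coord) : R -> R :=
  match i with cu => u | cv => v end.

Definition inner (r u v : R) (X Y : coord -> R) : R :=
  sumc (fun i => sumc (fun j => g r i j u v * X i * Y j)).

Definition velocity (u v : R -> R) (t : R) (i : coord) : R :=
  Derive (crv u v i) t.

Definition speed (r : R) (u v : R -> R) (t : R) : R :=
  sqrt (inner r (u t) (v t) (velocity u v t) (velocity u v t)).

Definition accel (r : R) (u v : R -> R) (t : R) (k : coord) : R :=
  Derive_n (crv u v k) 2 t +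
  sumc (fun i => sumc (fun j =>
    christoffel r k i j (u t) (v t) * velocity u v t i * velocity u v t j)).

Definition normal (r : R) (u v : R -> R) (t : R) (i : coord) : R :=
  / speed r u v t *
  match i with
  | cu => - (Derive v t * cosh (u t / r))
  | cv => Derive u t / cosh (u t / r)
  end.

Definition kappa (r : R) (u v : R -> R) (t : R) : R :=
  - inner r (u t) (v t) (accel r u v t) (normal r u v t) / speed r u v t ^ 2.

(* Nondegenerate interval: open, closed, half-open or unbounded. *)
Definition is_interval (J : R -> Prop) : Prop :=
  (forall a b t, J a -> J b -> a <= t <= b -> J t) /\
  (exists a b, J a /\ J b /\ a < b).

(* At an end point belonging to [J], smoothness means that of an extension
   past that point. *)
Definition smooth_on (J : R -> Prop) (f : R -> R) : Prop :=
  forall t, J t -> locally t (fun x => forall n, ex_derive_n f n x).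

Definition regular_on (J : R -> Prop) (u v : R -> R) : Prop :=
  forall t, J t -> ~ (forall i, velocity u v t i = 0).

Inductive catenary_type : Set := Elliptic | Hyperbolic | Parabolic.

Definition e_x : E4 := (1, 0, 0, 0).
Definition e_y : E4 := (0, 1, 0, 0).
Definition e_z : E4 := (0, 0, 1, 0).

(* The plane is the span of the two vectors, which are orthogonal. *)
Definition plane (ty : catenary_type) : E4 * E4 :=
  match ty with
  | Elliptic => (e_x, e_y)
  | Hyperbolic => (e_y, e_z)
  | Parabolic => (plus e_x e_y, e_z)
  end.

(* For [A], [B] orthogonal and non-null: the component of [p] orthogonal to
   span{A, B}. *)
Definition perp (A B p : E4) : E4 :=
  minus p (plus (scal (lor4 p A / lor4 A A) A) (scal (lor4 p B / lor4 B B) B)).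

(* The parabolic plane span{e_x + e_y, e_z} is degenerate, and points of
   the hyperbolic plane have no orthogonal projection onto it.  Its normal direction in {w = 0} is
   its own null vector [A = e_x + e_y], which cannot be normalized; the
   distance is the height |<p, A>|, defined up to a positive constant. *)
Definition dist_plane (ty : catenary_type) (p : E4) : R :=
  let (A, B) := plane ty in
  match ty with
  | Parabolic => Rabs (lor4 p A)
  | _ => sqrt (Rabs (lor4 (perp A B p) (perp A B p)))
  end.

Definition energy (ty : catenary_type) (r : R) (u v : R -> R) (a b : R) : R :=
  RInt (fun t => dist_plane ty (emb (psi r (u t) (v t))) * speed r u v t) a b.

(* Jointly C^infinity on a neighbourhood of ]-eps, eps[ x [a, b]. *)
Definition smooth_strip (eps a b : R) (F : R -> R -> R) : Prop :=
  forall s t, Rabs s < eps -> a <= t <= b ->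
    locally_2d (fun x y => forall n, ex_diff_n F n x y) s t.

(* [F s] is a variation of [f] over [a, b] with fixed end points. *)
Definition is_variation (f : R -> R) (eps a b : R) (F : R -> R -> R) : Prop :=
  smooth_strip eps a b F /\
  (forall t, a <= t <= b -> F 0 t = f t) /\
  (forall s, Rabs s < eps -> F s a = f a /\ F s b = f b).

(* As [psi r] is a global chart, the variations of the curve within the
   hyperbolic plane are those of its pair of coordinates. *)
Definition extrinsic_catenary (ty : catenary_type) (r : R) (J : R -> Prop)
    (u v : R -> R) : Prop :=
  forall (a b : R), J a -> J b -> a < b ->
  forall (eps : R) (U V : R -> R -> R), 0 < eps ->
    is_variation u eps a b U -> is_variation v eps a b V ->
    is_derive (fun s => energy ty r (U s) (V s) a b) 0 0.

Lemma cosh2_sinh2 (x : R) : cosh x ^ 2 - sinh x ^ 2 = 1.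
Proof.
unfold cosh, sinh.
assert (H : exp x * exp (- x) = 1)
  by (rewrite <- exp_plus, Rplus_opp_r; apply exp_0).
nra.
Qed.

Lemma cosh_gt0 (x : R) : 0 < cosh x.
Proof.
unfold cosh; pose proof (exp_pos x); pose proof (exp_pos (- x)); lra.
Qed.

Lemma psi_H2 (r u v : R) : 0 < r -> H2 r (psi r u v).
Proof.
intros hr; split; simpl.
- pose proof (cosh2_sinh2 (u / r)) as hu; pose proof (cosh2_sinh2 (v / r)) as hv.
  set (a := cosh (u / r)) in *; set (b := sinh (u / r)) in *.
  set (c := cosh (v / r)) in *; set (d := sinh (v / r)) in *.
  transitivity (- (r ^ 2) * (a ^ 2 * (c ^ 2 - d ^ 2) - b ^ 2)); [ring|].
  rewrite hv; replace (a ^ 2 * 1 - b ^ 2) with 1 by lra; ring.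
- pose proof (cosh_gt0 (u / r)); pose proof (cosh_gt0 (v / r)).
  apply Rmult_lt_0_compat; [exact hr|apply Rmult_lt_0_compat; assumption].
Qed.

Lemma is_derive_cosh (x : R) : is_derive cosh x (sinh x).
Proof. apply is_derive_Reals, derivable_pt_lim_cosh. Qed.

Lemma is_derive_sinh (x : R) : is_derive sinh x (cosh x).
Proof. apply is_derive_Reals, derivable_pt_lim_sinh. Qed.

Lemma is_derive_cosh_div (r x : R) :
  0 < r -> is_derive (fun y => cosh (y / r)) x (sinh (x / r) / r).
Proof.
intros hr.
evar_last; [apply (is_derive_comp cosh (fun y => y / r));
  [apply is_derive_cosh|auto_derive; [exact I|reflexivity]]|].
unfold scal; simpl; unfold mult; simpl; field; lra.
Qed.

Lemma is_derive_sinh_div (r x : R) :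
  0 < r -> is_derive (fun y => sinh (y / r)) x (cosh (x / r) / r).
Proof.
intros hr.
evar_last; [apply (is_derive_comp sinh (fun y => y / r));
  [apply is_derive_sinh|auto_derive; [exact I|reflexivity]]|].
unfold scal; simpl; unfold mult; simpl; field; lra.
Qed.

Lemma dpsi_psi (r u v : R) : 0 < r ->
  dpsi r cu u v = (sinh (u / r) * cosh (v / r), sinh (u / r) * sinh (v / r),
                   cosh (u / r)) /\
  dpsi r cv u v = (cosh (u / r) * sinh (v / r), cosh (u / r) * cosh (v / r), 0).
Proof.
intros hr; unfold dpsi, pd; simpl.
assert (hc : forall x, Derive (fun y => cosh (y / r)) x = sinh (x / r) / r)
  by (intros x; apply is_derive_unique, is_derive_cosh_div, hr).
assert (hs : forall x, Derive (fun y => sinh (y / r)) x = cosh (x / r) / r)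
  by (intros x; apply is_derive_unique, is_derive_sinh_div, hr).
split; f_equal; [f_equal| |f_equal|].
- rewrite Derive_scal, Derive_scal_l, hc; field; lra.
- rewrite Derive_scal, Derive_scal_l, hc; field; lra.
- rewrite Derive_scal, hs; field; lra.
- rewrite Derive_scal, Derive_scal, hc; field; lra.
- rewrite Derive_scal, Derive_scal, hs; field; lra.
- apply Derive_const.
Qed.

Lemma g_psi (r u v : R) : 0 < r ->
  g r cu cu u v = 1 /\ g r cu cv u v = 0 /\ g r cv cu u v = 0 /\
  g r cv cv u v = cosh (u / r) ^ 2.
Proof.
intros hr; unfold g; destruct (dpsi_psi r u v hr) as [-> ->].
unfold lor3.
pose proof (cosh2_sinh2 (u / r)) as hu; pose proof (cosh2_sinh2 (v / r)) as hv.
set (a := cosh (u / r)) in *; set (b := sinh (u / r)) in *.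
set (c := cosh (v / r)) in *; set (d := sinh (v / r)) in *.
repeat split.
- transitivity (a ^ 2 - b ^ 2 * (c ^ 2 - d ^ 2)); [ring|].
  rewrite hv; lra.
- ring.
- ring.
- transitivity (a ^ 2 * (c ^ 2 - d ^ 2)); [ring|].
  rewrite hv; ring.
Qed.

Lemma speed_psi (r : R) (u v : R -> R) (t : R) : 0 < r ->
  speed r u v t = sqrt (Derive u t ^ 2 + Derive v t ^ 2 * cosh (u t / r) ^ 2).
Proof.
intros hr; unfold speed, inner, sumc, velocity; simpl crv.
destruct (g_psi r (u t) (v t) hr) as (-> & -> & -> & ->).
f_equal; ring.
Qed.

Lemma dist_plane_psi (r u v : R) : 0 < r ->
  dist_plane Elliptic (emb (psi r u v)) = r * Rabs (sinh (u / r)) /\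
  dist_plane Hyperbolic (emb (psi r u v)) = r * (cosh (u / r) * cosh (v / r)) /\
  dist_plane Parabolic (emb (psi r u v)) = r * (exp (- v / r) * cosh (u / r)).
Proof.
intros hr; pose proof (cosh_gt0 (u / r)) as hcu; pose proof (cosh_gt0 (v / r)) as hcv.
assert (hsq : forall x y, x = y ^ 2 -> sqrt (Rabs x) = Rabs y)
  by (intros x y ->; rewrite Rabs_pos_eq by apply pow2_ge_0;
      rewrite <- Rsqr_pow2; apply sqrt_Rsqr_abs).
assert (hsq' : forall x y, x = - y ^ 2 -> sqrt (Rabs x) = Rabs y)
  by (intros x y ->; rewrite Rabs_Ropp, (hsq (y ^ 2) y eq_refl); reflexivity).
repeat split; unfold dist_plane, plane, perp, emb, psi, e_x, e_y, e_z, lor4;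
  simpl; unfold plus, opp, scal, mult; simpl; unfold mult; simpl.
- rewrite (hsq _ (r * sinh (u / r))) by field.
  rewrite Rabs_mult, (Rabs_pos_eq r) by lra; reflexivity.
- rewrite (hsq' _ (r * (cosh (u / r) * cosh (v / r)))) by field.
  apply Rabs_pos_eq, Rmult_le_pos; [lra|apply Rmult_le_pos; lra].
- replace (exp (- v / r)) with (cosh (v / r) - sinh (v / r)).
  + rewrite <- Rabs_Ropp, Rabs_pos_eq; [ring|].
    replace (- _) with (r * (cosh (u / r) * exp (- (v / r))))
      by (unfold cosh at 2, sinh; unfold cosh; field).
    pose proof (exp_pos (- (v / r))).
    apply Rmult_le_pos; [lra|apply Rmult_le_pos; lra].
  + replace (- v / r) with (- (v / r)) by (field; lra).
    unfold cosh, sinh; field.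
Qed.

(* Main.v *)
Require Import Defs.
From Stdlib Require Import Reals Lra Classical ClassicalEpsilon.
From Coquelicot Require Import Coquelicot.
Open Scope R_scope.

(** For an energy [int W(u, v) |gamma'|] write [p = u'], [q = v'],
    [c = cosh (u / r)], [sigma = |gamma'|].  Invariance under reparametrization
    makes the two Euler-Lagrange expressions proportional to [(- q, p)]; their
    common factor is [c / sigma] times the defect
    [kappa sigma W - (W_u q c - W_v p / c)].  The first variation along a field
    [(xi, eta)] is thus [int defect * (c / sigma) * (p eta - q xi)].
    For the converse no bump function is needed: the subinterval is free, so if
    the defect is nonzero at [t], shrink to a small [[a, b]] near [t] and vary by
    [(x - a) (b - x)] times the constant vector [(- v'(t), u'(t))].  The three
    types are the weights [sinh], [cosh * cosh], [cosh * exp]. *)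

(** * Calculus of smooth families *)

(** Compactness of [[a, b]]: every [t] lies within the chosen radius of some centre [y], and that
    radius is at least a common [d]. *)
Lemma tube (P : R -> R -> Prop) (x a b : R) :
  (forall t, a <= t <= b -> locally_2d P x t) ->
  exists d : posreal, forall s t, Rabs (s - x) < d -> a <= t <= b -> P s t.
Proof.
intros hP.
assert (hd : forall t, exists d : posreal, a <= t <= b ->
    forall s y, Rabs (s - x) < d -> Rabs (y - t) < d -> P s y).
{ intros t; destruct (classic (a <= t <= b)) as [ht|ht].
  - destruct (hP t ht) as [d h]; exists d; auto.
  (* A dummy radius, since [delta] has to be defined outside [[a, b]] as well. *)
  - exists (mkposreal 1 Rlt_0_1); intros; contradiction. }
set (delta := fun t => proj1_sig (constructive_indefinite_description _ (hd t))).
assert (hdelta : forall t, a <= t <= b ->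
    forall s y, Rabs (s - x) < delta t -> Rabs (y - t) < delta t -> P s y)
  by (intros t; exact (proj2_sig (constructive_indefinite_description _ (hd t)))).
destruct (compactness_value_1d a b delta) as [d h].
exists d; intros s t hs ht.
(* [compactness_value_1d] provides the centre [y] only under a double negation, so the goal is
   proved by contradiction. *)
apply NNPP; intros hn; apply (h t ht); intros (y & hy & hty & hdy).
apply hn, (hdelta y hy); lra.
Qed.

Section Continuity.
Context {T : UniformSpace}.
Implicit Types (f g : T -> R) (x : T).

Lemma continuous_Rplus f g x :
  continuous f x -> continuous g x -> continuous (fun z => f z + g z) x.
Proof. apply @continuous_plus. Qed.

Lemma continuous_Rminus f g x :
  continuous f x -> continuous g x -> continuous (fun z => f z - g z) x.
Proof. apply @continuous_minus. Qed.

Lemma continuous_Ropp f x : continuous f x -> continuous (fun z => - f z) x.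
Proof. apply @continuous_opp. Qed.

Lemma continuous_Rmult f g x :
  continuous f x -> continuous g x -> continuous (fun z => f z * g z) x.
Proof. apply @continuous_mult. Qed.

Lemma continuous_pow f n x :
  continuous f x -> continuous (fun z => f z ^ n) x.
Proof.
intros hf; induction n as [|n IH]; simpl.
- apply continuous_const.
- apply continuous_Rmult; assumption.
Qed.

Lemma continuous_Rdiv f g x :
  continuous f x -> continuous g x -> g x <> 0 ->
  continuous (fun z => f z / g z) x.
Proof.
intros hf hg hx; apply continuous_Rmult; [exact hf|].
apply (continuous_comp g Rinv); [exact hg|apply continuous_Rinv, hx].
Qed.

Lemma continuous_of_ex_derive f (h : R -> R) x :
  continuous f x -> ex_derive h (f x) -> continuous (fun z => h (f z)) x.
Proof.
intros hf hh; apply (continuous_comp f h); [exact hf|].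
exact (ex_derive_continuous h (f x) hh).
Qed.

Lemma continuous_sqrt_pos f x :
  continuous f x -> 0 < f x -> continuous (fun z => sqrt (f z)) x.
Proof.
intros hf hx; apply continuous_of_ex_derive; [exact hf|].
auto_derive; assumption.
Qed.

Lemma continuous_cosh_div f r x :
  0 < r -> continuous f x -> continuous (fun z => cosh (f z / r)) x.
Proof.
intros hr hf; apply (continuous_of_ex_derive f (fun y => cosh (y / r)));
  [exact hf|].
eexists; apply is_derive_cosh_div, hr.
Qed.

Lemma continuous_sinh_div f r x :
  0 < r -> continuous f x -> continuous (fun z => sinh (f z / r)) x.
Proof.
intros hr hf; apply (continuous_of_ex_derive f (fun y => sinh (y / r)));
  [exact hf|].
eexists; apply is_derive_sinh_div, hr.
Qed.

Lemma continuous_comp_continuity_2d (H : R -> R -> R) f g x :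
  continuous f x -> continuous g x -> continuity_2d_pt H (f x) (g x) ->
  continuous (fun z => H (f z) (g z)) x.
Proof.
intros hf hg hH.
apply (continuous_comp_2 f g H); [exact hf|exact hg|].
apply continuity_2d_pt_filterlim, hH.
Qed.

End Continuity.

(* Matching on the head symbol keeps unification from unfolding [Rplus] and
   [pow] when the wrong rule is tried. *)
Ltac continuity_arith :=
  try assumption;
  match goal with
  | |- continuous (fun _ => ?k) _ => apply continuous_const
  | |- continuous (fun z => @?f z + @?g z) _ =>
      apply (continuous_Rplus f g); continuity_arith
  | |- continuous (fun z => @?f z - @?g z) _ =>
      apply (continuous_Rminus f g); continuity_arith
  | |- continuous (fun z => - @?f z) _ =>
      apply (continuous_Ropp f); continuity_arith
  | |- continuous (fun z => @?f z / @?g z) _ =>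
      apply (continuous_Rdiv f g); continuity_arith
  | |- continuous (fun z => @?f z * @?g z) _ =>
      apply (continuous_Rmult f g); continuity_arith
  | |- continuous (fun z => @?f z ^ ?n) _ =>
      apply (continuous_pow f n); continuity_arith
  | |- continuous (fun z => sqrt (@?f z)) _ =>
      apply (continuous_sqrt_pos f); continuity_arith
  | |- continuous (fun z => cosh (@?f z / ?r)) _ =>
      apply (continuous_cosh_div f r); continuity_arith
  | |- continuous (fun z => sinh (@?f z / ?r)) _ =>
      apply (continuous_sinh_div f r); continuity_arith
  | |- _ => idtac
  end.

(** * Smooth functions of two variables *)

Definition smooth_at (F : R -> R -> R) (s t : R) : Prop :=
  forall n, ex_diff_n F n s t.

Definition D1 (F : R -> R -> R) (s t : R) : R := Derive (fun z => F z t) s.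
Definition D2 (F : R -> R -> R) (s t : R) : R := Derive (fun z => F s z) t.

(** The last two conjuncts of [ex_diff_n] at order [S n] are [ex_diff_n] at order [n] of the two
    partial derivatives. *)
Lemma smooth_at_D1 F s t : smooth_at F s t -> smooth_at (D1 F) s t.
Proof. intros h n; exact (proj1 (proj2 (proj2 (proj2 (h (S n)))))). Qed.

Lemma smooth_at_D2 F s t : smooth_at F s t -> smooth_at (D2 F) s t.
Proof. intros h n; exact (proj2 (proj2 (proj2 (proj2 (h (S n)))))). Qed.

Lemma smooth_at_is_derive1 F s t :
  smooth_at F s t -> is_derive (fun z => F z t) s (D1 F s t).
Proof. intros h; apply Derive_correct, (h 1%nat). Qed.

Lemma smooth_at_is_derive2 F s t :
  smooth_at F s t -> is_derive (fun z => F s z) t (D2 F s t).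
Proof. intros h; apply Derive_correct, (h 1%nat). Qed.

Lemma smooth_at_continuity F s t : smooth_at F s t -> continuity_2d_pt F s t.
Proof. intros h; exact (proj1 (h 1%nat)). Qed.

Lemma smooth_at_continuous F s t :
  smooth_at F s t -> continuous (fun z : R * R => F (fst z) (snd z)) (s, t).
Proof. intros h; apply continuity_2d_pt_filterlim, smooth_at_continuity, h. Qed.

Lemma smooth_at_continuous2 F s t :
  smooth_at F s t -> continuous (fun z => F s z) t.
Proof.
intros h; apply (ex_derive_continuous (fun z => F s z)).
eexists; apply smooth_at_is_derive2, h.
Qed.

(** Schwarz's theorem asks for the mixed partials in a neighbourhood, hence the local hypothesis,
    and for their continuity at the point only. *)
Lemma smooth_at_swap F s t :
  locally_2d (smooth_at F) s t -> D1 (D2 F) s t = D2 (D1 F) s t.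
Proof.
intros h; pose proof (locally_2d_singleton _ _ _ h) as h0.
apply (Schwarz F s t).
- apply (locally_2d_impl (smooth_at F)); [|exact h].
  apply locally_2d_forall; intros x y hxy.
  split; [|split; [|split]].
  + eexists; apply smooth_at_is_derive1, hxy.
  + eexists; apply smooth_at_is_derive2, hxy.
  + eexists; apply (smooth_at_is_derive1 (D2 F)), smooth_at_D2, hxy.
  + eexists; apply (smooth_at_is_derive2 (D1 F)), smooth_at_D1, hxy.
- apply (smooth_at_continuity (D1 (D2 F))), smooth_at_D1, smooth_at_D2, h0.
- apply (smooth_at_continuity (D2 (D1 F))), smooth_at_D2, smooth_at_D1, h0.
Qed.

(** * Weights with continuous partial derivatives *)

Definition C1_with_partials (W Wu Wv : R -> R -> R) : Prop :=
  forall x y, differentiable_pt_lim W x y (Wu x y) (Wv x y) /\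
    continuity_2d_pt Wu x y /\ continuity_2d_pt Wv x y.

Lemma C1_with_partials_continuity W Wu Wv x y :
  C1_with_partials W Wu Wv -> continuity_2d_pt W x y.
Proof.
intros h; apply differentiable_continuity_pt.
exists (Wu x y), (Wv x y); apply h.
Qed.

Lemma C1_with_partials_comp W Wu Wv f g t df dg :
  C1_with_partials W Wu Wv -> is_derive f t df -> is_derive g t dg ->
  is_derive (fun z => W (f z) (g z)) t
    (Wu (f t) (g t) * df + Wv (f t) (g t) * dg).
Proof.
intros h hf hg; apply is_derive_Reals, derivable_pt_lim_comp_2d;
  [apply h|apply is_derive_Reals, hf|apply is_derive_Reals, hg].
Qed.

(** Each of the three weights is such a product. Differentiability at a point follows from the
    [y]-partial there and an [x]-partial that exists nearby and is continuous at the point. *)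
Lemma C1_with_partials_prod (f df h dh : R -> R) :
  (forall x, is_derive f x (df x)) -> (forall x, continuous df x) ->
  (forall x, is_derive h x (dh x)) -> (forall x, continuous dh x) ->
  C1_with_partials (fun x y => f x * h y) (fun x y => df x * h y)
    (fun x y => f x * dh y).
Proof.
intros hf hdf hh hdh x y.
assert (cf : continuous f x) by (apply (ex_derive_continuous f); eexists; apply hf).
assert (ch : continuous h y) by (apply (ex_derive_continuous h); eexists; apply hh).
assert (c1 : forall k : R -> R, continuous k x ->
    continuous (fun z : R * R => k (fst z)) (x, y))
  by (intros k hk; apply (continuous_comp fst k); [apply continuous_fst|exact hk]).
assert (c2 : forall k : R -> R, continuous k y ->
    continuous (fun z : R * R => k (snd z)) (x, y))
  by (intros k hk; apply (continuous_comp snd k); [apply continuous_snd|exact hk]).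
split; [|split].
- apply filterdiff_differentiable_pt_lim.
  apply (is_derive_filterdiff (fun x y => f x * h y) x y (fun x y => df x * h y)).
  + apply filter_forall; intros [a b]; simpl.
    evar_last; [apply (is_derive_mult f (fun _ => h b));
      [apply hf|apply is_derive_const|intros; apply Rmult_comm]|].
    unfold plus, mult, zero; simpl; ring.
  + evar_last; [apply (is_derive_scal h y (f x)), hh|]. reflexivity.
  + apply continuous_Rmult; auto.
- apply continuity_2d_pt_filterlim; apply @continuous_Rmult; auto.
- apply continuity_2d_pt_filterlim; apply @continuous_Rmult; auto.
Qed.

(** * Curvature and the Euler-Lagrange expression *)

Lemma pd_g (r x y : R) (i j l : coord) : 0 < r ->
  pd i (g r j l) x y =
    match i, j, l with
    | cu, cv, cv => 2 * cosh (x / r) * sinh (x / r) / r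
    | _, _, _ => 0
    end.
Proof.
intros hr.
assert (hg : forall j l x y, g r j l x y =
    match j, l with cu, cu => 1 | cv, cv => cosh (x / r) ^ 2 | _, _ => 0 end)
  by (intros [] [] a b; destruct (g_psi r a b hr) as (? & ? & ? & ?); assumption).
destruct i; unfold pd.
- rewrite (Derive_ext _ _ _ (fun z => hg j l z y)).
  destruct j, l; try apply Derive_const.
  apply is_derive_unique.
  evar_last; [apply is_derive_pow, is_derive_cosh_div, hr|].
  simpl; field; lra.
- rewrite (Derive_ext _ _ _ (fun z => hg j l x z)).
  destruct j, l; apply Derive_const.
Qed.

Lemma christoffel_psi (r x y : R) (k i j : coord) : 0 < r ->
  christoffel r k i j x y =
    match k, i, j with
    | cu, cv, cv => - (cosh (x / r) * sinh (x / r) / r)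
    | cv, cu, cv | cv, cv, cu => sinh (x / r) / (r * cosh (x / r))
    | _, _, _ => 0
    end.
Proof.
intros hr; unfold christoffel, sumc, ginv, detg.
pose proof (cosh_gt0 (x / r)).
destruct (g_psi r x y hr) as (-> & -> & -> & ->).
rewrite !pd_g by exact hr.
destruct k, i, j; field; lra.
Qed.

(* In [metric_sq], [curvature], [defect] and [lagrangian_ds] below: [c], [s] are
   [cosh (u / r)], [sinh (u / r)] and [p], [q] are [u'], [v']. *)
Definition metric_sq (c p q : R) : R := p ^ 2 + q ^ 2 * c ^ 2.

Definition curvature (r c s p q p' q' : R) : R :=
  - (c / sqrt (metric_sq c p q) ^ 3 *
     (p * (q' + 2 * (s / (r * c)) * p * q) - q * (p' - c * s / r * q ^ 2))).

(** Lowering the index of the normal turns [(- q c, p / c)] into [(- q c, p c)], so [c] factors out.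
    The cube collects the speed in [normal] and its square in [kappa]. *)
Lemma kappa_psi (r : R) (u v : R -> R) (t : R) : 0 < r ->
  0 < metric_sq (cosh (u t / r)) (Derive u t) (Derive v t) ->
  kappa r u v t =
    curvature r (cosh (u t / r)) (sinh (u t / r)) (Derive u t) (Derive v t)
      (Derive (Derive u) t) (Derive (Derive v) t).
Proof.
intros hr hsq.
unfold kappa, curvature, inner, sumc, normal, accel, sumc, velocity.
rewrite speed_psi by exact hr.
rewrite !christoffel_psi by exact hr.
destruct (g_psi r (u t) (v t) hr) as (-> & -> & -> & ->).
simpl crv; pose proof (cosh_gt0 (u t / r)).
change (Derive_n u 2 t) with (Derive (Derive u) t).
change (Derive_n v 2 t) with (Derive (Derive v) t).
fold (metric_sq (cosh (u t / r)) (Derive u t) (Derive v t)).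
pose proof (sqrt_lt_R0 _ hsq).
field; lra.
Qed.

Lemma regular_metric_sq (r : R) (J : R -> Prop) (u v : R -> R) (t : R) :
  regular_on J u v -> J t ->
  0 < metric_sq (cosh (u t / r)) (Derive u t) (Derive v t).
Proof.
intros hreg ht; unfold metric_sq.
pose proof (cosh_gt0 (u t / r)) as hc.
destruct (Req_dec (Derive u t) 0) as [hu|hu].
- destruct (Req_dec (Derive v t) 0) as [hv|hv].
  + exfalso; apply (hreg t ht); intros []; assumption.
  + pose proof (pow2_ge_0 (Derive u t)).
    assert (0 < Derive v t ^ 2 * cosh (u t / r) ^ 2)
      by (rewrite <- Rpow_mult_distr;
          apply pow2_gt_0, Rmult_integral_contrapositive_currified; lra).
    lra.
- pose proof (pow2_gt_0 _ hu).
  pose proof (pow2_ge_0 (Derive v t * cosh (u t / r))) as h.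
  rewrite Rpow_mult_distr in h; lra.
Qed.

Definition defect (r c s p q p' q' w wu wv : R) : R :=
  curvature r c s p q p' q' * sqrt (metric_sq c p q) * w - (wu * q * c - wv * p / c).

(* [(x1, x2)] is the variation field and [(p1, q1)] its [t]-derivative. *)
Definition lagrangian_ds (r c s p q w wu wv x1 x2 p1 q1 : R) : R :=
  (wu * x1 + wv * x2) * sqrt (metric_sq c p q) +
  w * (p * p1 + c ^ 2 * q * q1 + c * (s / r) * x1 * q ^ 2) / sqrt (metric_sq c p q).

(* [auto_derive] leaves eta-expanded derivatives. *)
Lemma Derive_eta (f : R -> R) (x l : R) :
  is_derive f x l -> Derive (fun y : R => f y) x = l.
Proof. apply is_derive_unique. Qed.

(** Chain rule in the variation parameter [z] at fixed time. The functions [w], [c], [p], [q] vary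
    with [z]; [wu], [wv], [s] enter only through the derivatives of [w] and [c] at the point, so
    they are numbers. *)
Lemma is_derive_lagrangian (r wu wv s x1 x2 p1 q1 : R) (w c p q : R -> R) (z : R) :
  0 < r -> 0 < metric_sq (c z) (p z) (q z) ->
  is_derive w z (wu * x1 + wv * x2) -> is_derive c z (s / r * x1) ->
  is_derive p z p1 -> is_derive q z q1 ->
  is_derive (fun z => w z * sqrt (metric_sq (c z) (p z) (q z))) z
    (lagrangian_ds r (c z) s (p z) (q z) (w z) wu wv x1 x2 p1 q1).
Proof.
intros hr hsq hw hc hp hq; unfold lagrangian_ds.
pose proof (sqrt_lt_R0 _ hsq) as hsg; unfold metric_sq in *.
auto_derive.
- repeat split; try (eexists; eassumption); simpl in hsq; lra.
- replace (p z * (p z * 1) + q z * (q z * 1) * (c z * (c z * 1)))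
    with (p z ^ 2 + q z ^ 2 * c z ^ 2) by ring.
  rewrite (Derive_eta _ _ _ hw),
    (Derive_eta _ _ _ hc),
    (Derive_eta _ _ _ hp),
    (Derive_eta _ _ _ hq).
  field; lra.
Qed.

(* Integration by parts in differential form: [lagrangian_ds] is the
   Euler-Lagrange term plus an exact derivative. *)
Lemma is_derive_momentum (r wu wv s p' q' x1' x2' : R) (w c p q x1 x2 : R -> R) (t : R) :
  0 < r -> 0 < c t -> 0 < metric_sq (c t) (p t) (q t) ->
  is_derive w t (wu * p t + wv * q t) -> is_derive c t (s / r * p t) ->
  is_derive p t p' -> is_derive q t q' ->
  is_derive x1 t x1' -> is_derive x2 t x2' ->
  is_derive (fun t => w t * (p t * x1 t + c t ^ 2 * q t * x2 t)
      / sqrt (metric_sq (c t) (p t) (q t))) t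
    (lagrangian_ds r (c t) s (p t) (q t) (w t) wu wv (x1 t) (x2 t) x1' x2' -
     defect r (c t) s (p t) (q t) p' q' (w t) wu wv *
       (c t / sqrt (metric_sq (c t) (p t) (q t)) * (p t * x2 t - q t * x1 t))).
Proof.
intros hr hc0 hsq hw hc hp hq h1 h2; unfold lagrangian_ds, defect, curvature.
pose proof (sqrt_lt_R0 _ hsq) as hsg.
pose proof (pow2_sqrt _ (Rlt_le _ _ hsq)) as hss.
unfold metric_sq in *.
auto_derive.
- simpl in hsq, hsg; repeat split; try (eexists; eassumption); lra.
- replace (p t * (p t * 1) + q t * (q t * 1) * (c t * (c t * 1)))
    with (p t ^ 2 + q t ^ 2 * c t ^ 2) by ring.
  rewrite (Derive_eta _ _ _ hw),
    (Derive_eta _ _ _ hc),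
    (Derive_eta _ _ _ hp),
    (Derive_eta _ _ _ hq),
    (Derive_eta _ _ _ h1),
    (Derive_eta _ _ _ h2).
  (* With the square root replaced by an indeterminate [sg], the identity is rational modulo the
     relation [hss] for [sg ^ 2]. *)
  revert hsg hss; generalize (sqrt (p t ^ 2 + q t ^ 2 * c t ^ 2)) as sg.
  intros sg hsg hss.
  field [hss]; lra.
Qed.

(** * First variation *)

Lemma continuous_defect (T : UniformSpace) (c s p q p' q' w wu wv : T -> R) (r : R) (x : T) :
  0 < r -> 0 < c x -> 0 < metric_sq (c x) (p x) (q x) ->
  continuous c x -> continuous s x -> continuous p x -> continuous q x ->
  continuous p' x -> continuous q' x ->
  continuous w x -> continuous wu x -> continuous wv x ->
  continuous (fun z => defect r (c z) (s z) (p z) (q z) (p' z) (q' z) (w z)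
    (wu z) (wv z)) x.
Proof.
intros hr hc hsq; intros.
unfold defect, curvature, metric_sq in *.
pose proof (sqrt_lt_R0 _ hsq) as hsg.
continuity_arith.
all: apply Rgt_not_eq;
  first [assumption | apply pow_lt, hsg | apply Rmult_lt_0_compat; assumption].
Qed.

Lemma continuous_lagrangian_ds (T : UniformSpace)
  (c s p q w wu wv x1 x2 p1 q1 : T -> R) (r : R) (x : T) :
  0 < r -> 0 < metric_sq (c x) (p x) (q x) ->
  continuous c x -> continuous s x -> continuous p x -> continuous q x ->
  continuous w x -> continuous wu x -> continuous wv x ->
  continuous x1 x -> continuous x2 x -> continuous p1 x -> continuous q1 x ->
  continuous (fun z => lagrangian_ds r (c z) (s z) (p z) (q z) (w z)
    (wu z) (wv z) (x1 z) (x2 z) (p1 z) (q1 z)) x.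
Proof.
intros hr hsq; intros.
unfold lagrangian_ds, metric_sq in *.
pose proof (sqrt_lt_R0 _ hsq) as hsg.
continuity_arith; apply Rgt_not_eq; assumption.
Qed.

Definition defect_along (W Wu Wv : R -> R -> R) (r : R) (u v : R -> R) (t : R) : R :=
  defect r (cosh (u t / r)) (sinh (u t / r)) (Derive u t) (Derive v t)
    (Derive (Derive u) t) (Derive (Derive v) t)
    (W (u t) (v t)) (Wu (u t) (v t)) (Wv (u t) (v t)).

Definition twice_continuous (f : R -> R) (t : R) : Prop :=
  continuous f t /\ continuous (Derive f) t /\ continuous (Derive (Derive f)) t.

Definition speed_sq (r : R) (u v : R -> R) (t : R) : R :=
  metric_sq (cosh (u t / r)) (Derive u t) (Derive v t).

Lemma continuous_defect_along W Wu Wv r u v t :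
  0 < r -> C1_with_partials W Wu Wv ->
  twice_continuous u t -> twice_continuous v t -> 0 < speed_sq r u v t ->
  continuous (defect_along W Wu Wv r u v) t.
Proof.
intros hr hW (hu0 & hu1 & hu2) (hv0 & hv1 & hv2) hsq.
apply (@continuous_defect R_UniformSpace); try assumption;
  try (apply continuous_comp_continuity_2d; try assumption;
       first [apply hW | eapply C1_with_partials_continuity; exact hW]).
- apply cosh_gt0.
- apply continuous_cosh_div; assumption.
- apply continuous_sinh_div; assumption.
Qed.

Lemma smooth_at_twice_continuous F s t :
  smooth_at F s t -> twice_continuous (F s) t.
Proof.
intros h; split; [|split].
- apply smooth_at_continuous2, h.
- apply (smooth_at_continuous2 (D2 F)), smooth_at_D2, h.
- apply (smooth_at_continuous2 (D2 (D2 F))), smooth_at_D2, smooth_at_D2, h.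
Qed.

Definition lagrangian (W : R -> R -> R) (r : R) (u v : R -> R) (t : R) : R :=
  W (u t) (v t) * sqrt (speed_sq r u v t).

(** The factor multiplying the defect is the inner product of the variation field with the unit
    normal: tangential fields contribute nothing. *)
Definition variation_density W Wu Wv r (U V : R -> R -> R) (t : R) : R :=
  defect_along W Wu Wv r (U 0) (V 0) t *
    (cosh (U 0 t / r) / sqrt (speed_sq r (U 0) (V 0) t) *
     (Derive (U 0) t * D1 V 0 t - Derive (V 0) t * D1 U 0 t)).

Lemma is_derive_cosh_comp (r : R) (f : R -> R) (x df : R) : 0 < r ->
  is_derive f x df ->
  is_derive (fun z => cosh (f z / r)) x (sinh (f x / r) / r * df).
Proof.
intros hr hf.
evar_last; [apply (is_derive_comp (fun y => cosh (y / r)) f);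
  [apply is_derive_cosh_div, hr|exact hf]|].
unfold scal; simpl; unfold mult; simpl; ring.
Qed.

Section FirstVariation.

Variables (W Wu Wv : R -> R -> R) (r : R) (U V : R -> R -> R).
Hypotheses (hr : 0 < r) (hW : C1_with_partials W Wu Wv).

(** Defined for every [s], not just 0: differentiation under the integral sign uses the derivative
    near 0 and its joint continuity. *)
Let DL (s t : R) : R :=
  lagrangian_ds r (cosh (U s t / r)) (sinh (U s t / r)) (D2 U s t) (D2 V s t)
    (W (U s t) (V s t)) (Wu (U s t) (V s t)) (Wv (U s t) (V s t))
    (D1 U s t) (D1 V s t) (D1 (D2 U) s t) (D1 (D2 V) s t).

Let regular_at (s t : R) : Prop :=
  (smooth_at U s t /\ smooth_at V s t) /\ 0 < speed_sq r (U s) (V s) t.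

Lemma lagrangian_is_derive_s s t : regular_at s t ->
  is_derive (fun z => lagrangian W r (U z) (V z) t) s (DL s t).
Proof.
intros [[hU hV] hsq].
apply (is_derive_lagrangian r _ _ _ _ _ _ _ (fun z => W (U z t) (V z t))
  (fun z => cosh (U z t / r)) (fun z => D2 U z t) (fun z => D2 V z t)).
- exact hr.
- exact hsq.
- apply (C1_with_partials_comp W Wu Wv (fun z => U z t) (fun z => V z t)); [exact hW| |];
    first [exact (smooth_at_is_derive1 _ _ _ hU)
          |exact (smooth_at_is_derive1 _ _ _ hV)].
- apply (is_derive_cosh_comp r (fun z => U z t)); [exact hr|].
  apply smooth_at_is_derive1, hU.
- apply (smooth_at_is_derive1 (D2 U)), smooth_at_D2, hU.
- apply (smooth_at_is_derive1 (D2 V)), smooth_at_D2, hV.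
Qed.

Lemma continuous_lagrangian_t s t : regular_at s t ->
  continuous (lagrangian W r (U s) (V s)) t.
Proof.
intros [[hU hV] hsq].
destruct (smooth_at_twice_continuous U s t hU) as (? & ? & _).
destruct (smooth_at_twice_continuous V s t hV) as (? & ? & _).
unfold lagrangian, speed_sq, metric_sq in *.
apply @continuous_Rmult.
- apply continuous_comp_continuity_2d; try assumption.
  eapply C1_with_partials_continuity, hW.
- continuity_arith.
Qed.

Lemma DL_continuity s t : regular_at s t -> continuity_2d_pt DL s t.
Proof.
intros [[hU hV] hsq].
apply continuity_2d_pt_filterlim.
pose proof (smooth_at_continuous U s t hU).
pose proof (smooth_at_continuous V s t hV).
apply (continuous_lagrangian_ds _
  (fun z : R * R => cosh (U (fst z) (snd z) / r))
  (fun z : R * R => sinh (U (fst z) (snd z) / r))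
  (fun z : R * R => D2 U (fst z) (snd z)) (fun z : R * R => D2 V (fst z) (snd z))
  (fun z : R * R => W (U (fst z) (snd z)) (V (fst z) (snd z)))
  (fun z : R * R => Wu (U (fst z) (snd z)) (V (fst z) (snd z)))
  (fun z : R * R => Wv (U (fst z) (snd z)) (V (fst z) (snd z)))
  (fun z : R * R => D1 U (fst z) (snd z)) (fun z : R * R => D1 V (fst z) (snd z))
  (fun z : R * R => D1 (D2 U) (fst z) (snd z))
  (fun z : R * R => D1 (D2 V) (fst z) (snd z))); try assumption;
  try (apply continuous_comp_continuity_2d; try assumption;
       first [apply hW | eapply C1_with_partials_continuity; exact hW]);
  try (apply smooth_at_continuous;
       repeat first [assumption | apply smooth_at_D1 | apply smooth_at_D2]).
- apply continuous_cosh_div; assumption.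
- apply continuous_sinh_div; assumption.
Qed.

(** The boundary term of the integration by parts: the variation field paired with the conjugate
    momenta [W p / sigma] and [W c ^ 2 q / sigma]. *)
Let momentum (t : R) : R :=
  W (U 0 t) (V 0 t) *
    (D2 U 0 t * D1 U 0 t + cosh (U 0 t / r) ^ 2 * D2 V 0 t * D1 V 0 t) /
    sqrt (speed_sq r (U 0) (V 0) t).

Lemma momentum_is_derive t :
  locally_2d (smooth_at U) 0 t -> locally_2d (smooth_at V) 0 t ->
  0 < speed_sq r (U 0) (V 0) t ->
  is_derive momentum t (DL 0 t - variation_density W Wu Wv r U V t).
Proof.
intros hU hV hsq.
pose proof (locally_2d_singleton _ _ _ hU) as hU0.
pose proof (locally_2d_singleton _ _ _ hV) as hV0.
(* [DL] contains the [s]-derivative of the velocity; integration by parts needs the [t]-derivative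
   of the variation field. *)
unfold DL; rewrite (smooth_at_swap U 0 t hU), (smooth_at_swap V 0 t hV).
apply (is_derive_momentum r (Wu (U 0 t) (V 0 t)) (Wv (U 0 t) (V 0 t))
  (sinh (U 0 t / r)) (D2 (D2 U) 0 t) (D2 (D2 V) 0 t)
  (D2 (D1 U) 0 t) (D2 (D1 V) 0 t)
  (fun t => W (U 0 t) (V 0 t)) (fun t => cosh (U 0 t / r))
  (D2 U 0) (D2 V 0) (D1 U 0) (D1 V 0)).
- exact hr.
- apply cosh_gt0.
- exact hsq.
- apply (C1_with_partials_comp W Wu Wv (U 0) (V 0)); [exact hW| |];
    first [exact (smooth_at_is_derive2 _ _ _ hU0)
          |exact (smooth_at_is_derive2 _ _ _ hV0)].
- apply (is_derive_cosh_comp r (fun z => U 0 z)); [exact hr|].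
  apply smooth_at_is_derive2, hU0.
- apply (smooth_at_is_derive2 (D2 U)), smooth_at_D2, hU0.
- apply (smooth_at_is_derive2 (D2 V)), smooth_at_D2, hV0.
- apply (smooth_at_is_derive2 (D1 U)), smooth_at_D1, hU0.
- apply (smooth_at_is_derive2 (D1 V)), smooth_at_D1, hV0.
Qed.

Lemma continuous_variation_density t : regular_at 0 t ->
  continuous (variation_density W Wu Wv r U V) t.
Proof.
intros [[hU hV] hsq].
pose proof (smooth_at_twice_continuous U 0 t hU) as hU2.
pose proof (smooth_at_twice_continuous V 0 t hV) as hV2.
apply @continuous_Rmult.
- apply continuous_defect_along; assumption.
- pose proof (smooth_at_continuous2 (D1 U) 0 t (smooth_at_D1 _ _ _ hU)).
  pose proof (smooth_at_continuous2 (D1 V) 0 t (smooth_at_D1 _ _ _ hV)).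
  destruct hU2 as (? & ? & _), hV2 as (? & ? & _).
  unfold speed_sq, metric_sq in *.
  continuity_arith.
  apply Rgt_not_eq, sqrt_lt_R0, hsq.
Qed.

(** Differentiation under the integral, then integration by parts with a vanishing boundary term.
    Positivity of the speed is an open condition, so it spreads from [s = 0] to a strip given by
    [tube]. *)
Lemma first_variation (eps a b : R) :
  0 < eps -> a <= b -> smooth_strip eps a b U -> smooth_strip eps a b V ->
  (forall s, Rabs s < eps -> U s a = U 0 a /\ U s b = U 0 b) ->
  (forall s, Rabs s < eps -> V s a = V 0 a /\ V s b = V 0 b) ->
  (forall t, a <= t <= b -> 0 < speed_sq r (U 0) (V 0) t) ->
  is_derive (fun s => RInt (lagrangian W r (U s) (V s)) a b) 0
    (RInt (variation_density W Wu Wv r U V) a b).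
Proof.
intros heps hab hU hV hUe hVe hsq.
assert (h0 : Rabs 0 < eps) by (rewrite Rabs_R0; exact heps).
assert (hreg : forall t, a <= t <= b -> locally_2d regular_at 0 t).
{ intros t ht.
  pose proof (hU 0 t h0 ht) as hUt; pose proof (hV 0 t h0 ht) as hVt.
  apply locally_2d_and; [apply locally_2d_and; assumption|].
  pose proof (locally_2d_singleton _ _ _ hUt) as hU0.
  pose proof (locally_2d_singleton _ _ _ hVt) as hV0.
  pose proof (smooth_at_continuous U 0 t hU0).
  pose proof (smooth_at_continuous (D2 U) 0 t (smooth_at_D2 _ _ _ hU0)).
  pose proof (smooth_at_continuous (D2 V) 0 t (smooth_at_D2 _ _ _ hV0)).
  assert (hc : continuous (fun z : R * R =>
      speed_sq r (U (fst z)) (V (fst z)) (snd z)) (0, t))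
    by (unfold speed_sq, metric_sq; continuity_arith).
  apply (locally_2d_locally (fun s t => 0 < speed_sq r (U s) (V s) t)).
  apply hc, (open_gt 0), hsq, ht. }
destruct (tube regular_at 0 a b hreg) as [d hd].
assert (hloc : locally 0 (fun s => forall t, a <= t <= b -> regular_at s t)).
{ exists d; intros s hs t ht; apply hd; [exact hs|exact ht]. }
assert (hmin : Rmin a b = a) by (apply Rmin_left, hab).
assert (hmax : Rmax a b = b) by (apply Rmax_right, hab).
evar_last.
- apply (is_derive_RInt_param (fun s t => lagrangian W r (U s) (V s) t)).
  all: rewrite ?hmin, ?hmax.
  + apply (filter_imp _ _ (fun s hs t ht =>
      ex_intro _ _ (lagrangian_is_derive_s s t (hs t ht))) hloc).
  + intros t ht.
    apply (continuity_2d_pt_ext_loc DL).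
    * apply (locally_2d_impl regular_at); [|exact (hreg t ht)].
      apply locally_2d_forall; intros s y hsy.
      symmetry; apply is_derive_unique, lagrangian_is_derive_s, hsy.
    * apply DL_continuity, (locally_2d_singleton _ _ _ (hreg t ht)).
  + apply (filter_imp (fun s => forall t, a <= t <= b -> regular_at s t));
      [|exact hloc].
    intros s hs; apply (ex_RInt_continuous (V := R_CompleteNormedModule)).
    rewrite hmin, hmax; intros t ht; apply continuous_lagrangian_t, hs, ht.
- assert (hreg0 : forall t, a <= t <= b -> regular_at 0 t)
    by (intros t ht; exact (locally_2d_singleton _ _ _ (hreg t ht))).
  assert (hdens : forall t, a <= t <= b ->
      continuous (variation_density W Wu Wv r U V) t)
    by (intros t ht; apply continuous_variation_density, hreg0, ht).
  assert (hDL : forall t, a <= t <= b -> continuous (DL 0) t).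
  { intros t ht.
    apply (continuous_comp_continuity_2d DL (fun _ => 0) (fun y => y));
      [apply continuous_const|apply continuous_id|apply DL_continuity, hreg0, ht]. }
  assert (hm : is_RInt (fun t => DL 0 t - variation_density W Wu Wv r U V t) a b
      (minus (momentum b) (momentum a))).
  { apply (is_RInt_derive (V := R_CompleteNormedModule)); rewrite hmin, hmax; intros t ht.
    - apply momentum_is_derive;
        [exact (hU 0 t h0 ht)|exact (hV 0 t h0 ht)|exact (hsq t ht)].
    - apply @continuous_Rminus; [apply hDL|apply hdens]; exact ht. }
  (* At a fixed end point the variation is locally constant in [s], so the field vanishes there and
     [momentum] with it. *)
  assert (hend : forall F t, (forall s, Rabs s < eps -> F s t = F 0 t) -> D1 F 0 t = 0).
  { intros F t hF; unfold D1.
    rewrite (Derive_ext_loc _ (fun _ => F 0 t)); [apply Derive_const|].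
    exists (mkposreal eps heps); intros s hs; apply hF.
    rewrite <- (Rminus_0_r s); exact hs. }
  assert (hz : minus (momentum b) (momentum a) = 0).
  { unfold momentum.
    rewrite !(hend U), !(hend V) by (intros; first [apply hUe|apply hVe]; assumption).
    unfold minus, plus, opp; simpl; unfold Rdiv; ring. }
  rewrite hz in hm.
  rewrite (RInt_ext _ (DL 0)) by
    (rewrite hmin, hmax; intros t ht;
     apply is_derive_unique, lagrangian_is_derive_s, hreg0; lra).
  assert (hi : ex_RInt (variation_density W Wu Wv r U V) a b)
    by (apply (ex_RInt_continuous (V := R_CompleteNormedModule));
        rewrite hmin, hmax; exact hdens).
  (* [DL 0] minus the density integrates to 0 by [hm]; adding the density back gives the integral of
     [DL 0]. *)
  pose proof (is_RInt_plus _ _ _ _ _ _ hm (RInt_correct _ _ _ hi)) as hs.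
  transitivity (plus 0 (RInt (variation_density W Wu Wv r U V) a b));
    [|apply Rplus_0_l].
  apply is_RInt_unique.
  apply (is_RInt_ext (V := R_NormedModule)) with (2 := hs).
  intros t _; unfold plus; simpl; ring.
Qed.

End FirstVariation.

(** * Critical points *)

(** The subinterval is taken on one side of [t], to the right unless [t = b], so that end points are
    covered too. *)
Lemma locally_subinterval (P : R -> Prop) (a b t : R) :
  a < b -> a <= t <= b -> locally t P ->
  exists c d, a <= c /\ c < d /\ d <= b /\ forall x, c <= x <= d -> P x.
Proof.
intros hab ht [e he].
pose proof (cond_pos e) as hpos.
assert (hP : forall x, t - e < x < t + e -> P x)
  by (intros x hx; apply he; unfold ball; simpl; unfold AbsRing_ball, abs, minus, plus, opp;
      simpl; apply Rabs_def1; lra).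
destruct (Rlt_dec t b) as [htb|htb].
- exists t, (Rmin b (t + e / 2)).
  pose proof (Rmin_l b (t + e / 2)); pose proof (Rmin_r b (t + e / 2)).
  split; [lra|split; [apply Rmin_glb_lt; lra|split; [lra|]]].
  intros x hx; apply hP; lra.
- exists (Rmax a (t - e / 2)), t.
  pose proof (Rmax_l a (t - e / 2)); pose proof (Rmax_r a (t - e / 2)).
  split; [lra|split; [apply Rmax_lub_lt; lra|split; [lra|]]].
  intros x hx; apply hP; lra.
Qed.

(** If the values differed at [t] they would differ on a whole subinterval, whose midpoint is
    interior. This carries equalities of derivatives to the end points. *)
Lemma continuous_eq_of_open (f h : R -> R) (a b t : R) :
  a < b -> a <= t <= b -> continuous f t -> continuous h t ->
  (forall x, a < x < b -> f x = h x) -> f t = h t.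
Proof.
intros hab ht hf hh heq.
apply NNPP; intros hne.
assert (hloc : locally t (fun x => f x - h x <> 0)).
{ apply (continuous_Rminus f h t hf hh (fun y => y <> 0)), open_neq; lra. }
destruct (locally_subinterval _ a b t hab ht hloc) as (c & d & hc & hcd & hd & hx).
apply (hx ((c + d) / 2)); [lra|].
rewrite heq by lra; ring.
Qed.

(** Stands in for the fundamental lemma of the calculus of variations. Where [F] keeps a strict
    sign, the integrand has that sign inside [[c, d]]; the negative case is reduced to [- F]. *)
Lemma RInt_continuous_ne_0 (F : R -> R) (a b t : R) :
  a < b -> a <= t <= b -> (forall x, a <= x <= b -> continuous F x) -> F t <> 0 ->
  exists c d, a <= c /\ c < d /\ d <= b /\
    RInt (fun x => F x * ((x - c) * (d - x))) c d <> 0.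
Proof.
assert (pos : forall G : R -> R, a < b -> a <= t <= b ->
    (forall x, a <= x <= b -> continuous G x) -> 0 < G t ->
    exists c d, a <= c /\ c < d /\ d <= b /\
      0 < RInt (fun x => G x * ((x - c) * (d - x))) c d).
{ intros G hab ht hG hpos.
  destruct (locally_subinterval (fun x => 0 < G x) a b t hab ht)
    as (c & d & hc & hcd & hd & hx).
  - apply (hG t ht), open_gt, hpos.
  - exists c, d; repeat split; try assumption.
    apply RInt_gt_0; [exact hcd| |].
    + intros x h; apply Rmult_lt_0_compat; [apply hx; lra|].
      apply Rmult_lt_0_compat; lra.
    + intros x h; assert (continuous G x) by (apply hG; lra).
      pose proof (continuous_id (U := R_UniformSpace) x).
      continuity_arith. }
intros hab ht hF hne.
destruct (Rdichotomy _ _ hne) as [hn|hp].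
- destruct (pos (fun x => - F x) hab ht) as (c & d & hc & hcd & hd & h).
  + intros x hx; apply @continuous_Ropp, hF, hx.
  + lra.
  + exists c, d; repeat split; try assumption; intros h0.
    assert (hi : ex_RInt (fun x => F x * ((x - c) * (d - x))) c d).
    { apply (ex_RInt_continuous (V := R_CompleteNormedModule)).
      rewrite Rmin_left, Rmax_right by lra; intros x hx.
      assert (continuous F x) by (apply hF; lra).
      pose proof (continuous_id (U := R_UniformSpace) x).
      continuity_arith. }
    pose proof (RInt_opp _ _ _ hi) as ho.
    rewrite (RInt_ext _ (fun x => - F x * ((x - c) * (d - x)))) in ho
      by (intros; unfold opp; simpl; ring).
    rewrite ho, h0 in h; unfold opp in h; simpl in h; lra.
- destruct (pos F hab ht hF hp) as (c & d & hc & hcd & hd & h).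
  exists c, d; repeat split; try assumption; lra.
Qed.

(** * Smoothness of the variations affine in the parameter *)

Definition smooth_near (f : R -> R) (t : R) : Prop :=
  locally t (fun x => forall n, ex_derive_n f n x).

Lemma smooth_near_of_smooth (f : R -> R) (t : R) :
  (forall n x, ex_derive_n f n x) -> smooth_near f t.
Proof. intros h; exists (mkposreal 1 Rlt_0_1); auto. Qed.

Lemma smooth_near_Derive f t : smooth_near f t -> smooth_near (Derive f) t.
Proof.
unfold smooth_near; apply filter_imp; intros x hx [|n]; [exact I|].
apply (ex_derive_ext (Derive_n f (S n))); [|exact (hx (S (S n)))].
intros y; symmetry.
(* [Derive_n] adds derivatives on the outside; composing order [n] with order 1 moves one to the
   inside. *)
rewrite <- (Nat.add_1_r n), <- (Derive_n_comp f n 1); reflexivity.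
Qed.

Lemma smooth_near_ex_derive f t : smooth_near f t -> ex_derive f t.
Proof. intros h; exact (locally_singleton _ _ h 1%nat). Qed.

Lemma smooth_near_twice_continuous f t : smooth_near f t -> twice_continuous f t.
Proof.
intros h0; pose proof (smooth_near_Derive f t h0) as h1.
pose proof (smooth_near_Derive _ t h1) as h2.
repeat split; [apply (ex_derive_continuous f)|apply (ex_derive_continuous (Derive f))
  |apply (ex_derive_continuous (Derive (Derive f)))];
  apply smooth_near_ex_derive; assumption.
Qed.

Lemma locally_2d_of_locally (P : R -> Prop) (x y : R) :
  locally y P -> locally_2d (fun _ v => P v) x y.
Proof. intros [d hd]; exists d; intros u v _ hv; apply hd, hv. Qed.

(** Induction on the order: the partials of [f t + s * h t] are [h t + s * 0] and [f' t + s * h' t],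
    again of this form. Hence [f] and [h] are quantified after [n]. *)
Lemma affine_ex_diff_n n : forall (f h : R -> R) (s t : R),
  smooth_near f t -> smooth_near h t ->
  ex_diff_n (fun s t => f t + s * h t) n s t.
Proof.
assert (hcont : forall (f h : R -> R) (s t : R),
    smooth_near f t -> smooth_near h t ->
    continuity_2d_pt (fun s t => f t + s * h t) s t).
{ intros f h s t hf hh.
  apply continuity_2d_pt_plus; [|apply continuity_2d_pt_mult].
  - apply (continuity_1d_2d_pt_comp f (fun _ y => y)); [|apply continuity_2d_pt_id2].
    apply continuity_pt_filterlim, (ex_derive_continuous f), smooth_near_ex_derive, hf.
  - apply continuity_2d_pt_id1.
  - apply (continuity_1d_2d_pt_comp h (fun _ y => y)); [|apply continuity_2d_pt_id2].
    apply continuity_pt_filterlim, (ex_derive_continuous h), smooth_near_ex_derive, hh. }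
induction n as [|n IH]; intros f h s t hf hh; (split; [apply hcont; assumption|]).
  exact I.
split; [auto_derive; exact I|split; [|split]].
- pose proof (smooth_near_ex_derive f t hf); pose proof (smooth_near_ex_derive h t hh).
  auto_derive; repeat split; assumption.
- apply (ex_diff_n_ext_loc (fun s t => h t + s * 0)); [|apply (IH h (fun _ => 0))].
  + apply locally_2d_forall; intros x y; symmetry.
    apply is_derive_unique; auto_derive; [exact I|ring].
  + exact hh.
  + apply smooth_near_of_smooth; intros m x; apply ex_derive_n_const.
- apply (ex_diff_n_ext_loc (fun s t => Derive f t + s * Derive h t));
    [|apply IH; apply smooth_near_Derive; assumption].
  (* [f] and [h] are differentiable only near [t], so the formula for the [t]-partial is a local
     one. *)
  assert (hloc : locally t (fun y => ex_derive f y /\ ex_derive h y)).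
  { apply filter_and; [apply (filter_imp (fun x => forall n, ex_derive_n f n x)) with (2 := hf)
      |apply (filter_imp (fun x => forall n, ex_derive_n h n x)) with (2 := hh)];
      intros x hx; exact (hx 1%nat). }
  apply (locally_2d_impl _ _ _ _) with (2 := locally_2d_of_locally _ s t hloc).
  apply locally_2d_forall; intros x y [hfy hhy]; symmetry.
  rewrite Derive_plus, Derive_scal; [reflexivity|exact hfy|auto_derive; exact hhy].
Qed.

Lemma ex_derive_n_bump (k c d : R) n x : ex_derive_n (fun t => k * ((t - c) * (d - t))) n x.
Proof.
(* Expanded into monomials, with [t ^ 1] for [t], so that the rule for powers applies. *)
apply (ex_derive_n_ext (fun t => k * (((c + d) * t ^ 1 - t ^ 2) - c * d)));
  [intros t; ring|].
apply ex_derive_n_scal_l, ex_derive_n_minus; apply filter_forall; intros y m _;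
  [|apply ex_derive_n_const].
apply ex_derive_n_minus; apply filter_forall; intros z i _;
  [apply ex_derive_n_scal_l|]; apply ex_derive_n_pow.
Qed.

(** The quadratic vanishes at both ends. The bound 1 on the parameter is arbitrary, the family being
    smooth for every [s]. *)
Lemma affine_is_variation (f : R -> R) (k c d : R) :
  (forall t, c <= t <= d -> smooth_near f t) ->
  is_variation f 1 c d (fun s t => f t + s * (k * ((t - c) * (d - t)))).
Proof.
intros hf; split; [|split].
- intros s t _ ht.
  apply (locally_2d_impl (fun _ y => smooth_near f y));
    [|apply locally_2d_of_locally, locally_locally, hf, ht].
  apply locally_2d_forall; intros x y hy n.
  apply affine_ex_diff_n; [exact hy|].
  apply smooth_near_of_smooth; intros m z; apply ex_derive_n_bump.
- intros; ring.
- intros; split; ring.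
Qed.

(** * Critical points of a weighted length *)

Section Critical.

Variables (ty : catenary_type) (W Wu Wv : R -> R -> R) (r : R) (u v : R -> R).
(** [hdist] is restricted to [0 < W] because the elliptic distance [r * Rabs (sinh (u / r))] agrees
    with the smooth weight on one side of the plane only. *)
Hypotheses (hr : 0 < r) (hW : C1_with_partials W Wu Wv)
  (hdist : forall x y, 0 < W x y -> dist_plane ty (emb (psi r x y)) = W x y).

Let gradient (t : R) : R :=
  defect_along W Wu Wv r u v t * (cosh (u t / r) / sqrt (speed_sq r u v t)).

Lemma energy_variation (eps a b : R) (U V : R -> R -> R) :
  0 < eps -> a < b -> is_variation u eps a b U -> is_variation v eps a b V ->
  (forall t, a <= t <= b -> smooth_near u t) ->
  (forall t, a <= t <= b -> smooth_near v t) ->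
  (forall t, a <= t <= b -> 0 < W (u t) (v t)) ->
  (forall t, a <= t <= b -> 0 < speed_sq r u v t) ->
  is_derive (fun s => energy ty r (U s) (V s) a b) 0
    (RInt (fun t => gradient t *
      (Derive u t * D1 V 0 t - Derive v t * D1 U 0 t)) a b).
Proof.
intros heps hab (hU & hU0 & hUe) (hV & hV0 & hVe) hu hv hpos hsq.
assert (h0 : Rabs 0 < eps) by (rewrite Rabs_R0; exact heps).
assert (hmin : Rmin a b = a) by (apply Rmin_left; lra).
assert (hmax : Rmax a b = b) by (apply Rmax_right; lra).
assert (hin : forall (f : R -> R) (F : R -> R -> R) t,
    (forall t, a <= t <= b -> F 0 t = f t) -> a < t < b ->
    locally t (fun x : R => F 0 x = f x)).
{ intros f F t hF ht.
  apply (filter_imp (fun x => a < x /\ x < b)); [intros x hx; apply hF; lra|].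
  apply filter_and; [apply (open_gt a)|apply (open_lt b)]; lra. }
(* [F 0] and [f] agree on [[a, b]] only, so their derivatives are compared inside and the equality
   reaches the ends by continuity. *)
assert (hD : forall f F, (forall t, a <= t <= b -> smooth_near f t) ->
    smooth_strip eps a b F -> (forall t, a <= t <= b -> F 0 t = f t) ->
    forall t, a <= t <= b -> Derive (F 0) t = Derive f t).
{ intros f F hf hF hF0 t ht.
  apply (continuous_eq_of_open _ _ a b); [exact hab|exact ht| | |].
  - apply (smooth_at_twice_continuous F 0 t).
    exact (locally_2d_singleton _ _ _ (hF 0 t h0 ht)).
  - apply (smooth_near_twice_continuous f t), hf, ht.
  - intros x hx; apply Derive_ext_loc, hin; assumption. }
apply (is_derive_ext_loc (fun s => RInt (lagrangian W r (U s) (V s)) a b)).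
(* For small [s] the varied curve stays where [W] is positive, and there the distance is the
   weight. *)
- destruct (tube (fun s t => 0 < W (U s t) (V s t)) 0 a b) as [d hd].
  { intros t ht.
    apply (locally_2d_locally (fun s t => 0 < W (U s t) (V s t))).
    assert (hc : continuous
      (fun z : R * R => W (U (fst z) (snd z)) (V (fst z) (snd z))) (0, t)).
    { apply continuous_comp_continuity_2d;
        [apply smooth_at_continuous..|eapply C1_with_partials_continuity, hW].
      - exact (locally_2d_singleton _ _ _ (hU 0 t h0 ht)).
      - exact (locally_2d_singleton _ _ _ (hV 0 t h0 ht)). }
    apply hc, (open_gt 0); simpl.
    rewrite hU0, hV0 by exact ht; apply hpos, ht. }
  exists d; intros s hs; apply RInt_ext; rewrite hmin, hmax; intros t ht.
  unfold lagrangian; rewrite speed_psi by exact hr.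
  rewrite hdist; [reflexivity|apply hd; [exact hs|lra]].
- replace (RInt _ a b) with (RInt (variation_density W Wu Wv r U V) a b).
  + apply (first_variation W Wu Wv r U V hr hW eps); try assumption; [lra|..].
    * intros s hs; destruct (hUe s hs) as [-> ->], (hUe 0 h0) as [-> ->].
      split; reflexivity.
    * intros s hs; destruct (hVe s hs) as [-> ->], (hVe 0 h0) as [-> ->].
      split; reflexivity.
    * intros t ht; unfold speed_sq.
      rewrite (hD u U), (hD v V), hU0 by assumption; apply hsq, ht.
  + apply RInt_ext; rewrite hmin, hmax; intros t ht.
    assert (ht' : a <= t <= b) by lra.
    unfold gradient, variation_density, defect_along, speed_sq.
    (* Second derivatives are needed only at interior points, around which the curves coincide. *)
    rewrite (Derive_ext_loc (Derive (U 0)) (Derive u)),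
      (Derive_ext_loc (Derive (V 0)) (Derive v)).
    * rewrite (hD u U), (hD v V), hU0, hV0 by assumption.
      symmetry; apply Rmult_assoc.
    * apply (filter_imp _ _ (fun x => Derive_ext_loc (V 0) v x)).
      apply locally_locally, (hin v V); assumption.
    * apply (filter_imp _ _ (fun x => Derive_ext_loc (U 0) u x)).
      apply locally_locally, (hin u U); assumption.
Qed.

Variable J : R -> Prop.
Hypotheses (hJ : is_interval J) (hu : smooth_on J u) (hv : smooth_on J v)
  (hreg : regular_on J u v) (hpos : forall t, J t -> 0 < W (u t) (v t)).

Lemma extrinsic_catenary_iff_defect :
  extrinsic_catenary ty r J u v <->
  forall t, J t -> defect_along W Wu Wv r u v t = 0.
Proof.
destruct hJ as [hconv (a0 & b0 & ha0 & hb0 & hab0)].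
assert (hsq : forall t, J t -> 0 < speed_sq r u v t)
  by (intros t ht; exact (regular_metric_sq r J u v t hreg ht)).
split; intros H.
- intros t ht; apply NNPP; intros hne.
  (* [t] may be an end point of [J]; nondegeneracy of [J] gives room on at least one side. *)
  assert (hI : exists a b, J a /\ J b /\ a < b /\ a <= t <= b).
  { destruct (Rlt_dec t b0).
    - exists t, b0; repeat split; try assumption; lra.
    - exists a0, t; repeat split; try assumption; lra. }
  destruct hI as (a & b & ha & hb & hab & htab).
  (* With this constant field, [p * l - q * k] equals [p ^ 2 + q ^ 2] at [t], which is nonzero by
     regularity. *)
  set (k := - Derive v t); set (l := Derive u t).
  destruct (RInt_continuous_ne_0
    (fun x => gradient x * (Derive u x * l - Derive v x * k)) a b t hab htab)
    as (c & d & hc & hcd & hd & hI).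
  + intros x hx; assert (hJx : J x) by (apply (hconv a b); assumption).
    pose proof (smooth_near_twice_continuous u x (hu x hJx)) as hu2.
    pose proof (smooth_near_twice_continuous v x (hv x hJx)) as hv2.
    assert (continuous (defect_along W Wu Wv r u v) x)
      by (apply continuous_defect_along; auto).
    destruct hu2 as (? & ? & _), hv2 as (? & ? & _).
    pose proof (hsq x hJx) as hsqx; unfold gradient, speed_sq, metric_sq in *.
    continuity_arith.
    apply Rgt_not_eq, sqrt_lt_R0, hsqx.
  + unfold k, l, gradient.
    pose proof (hsq t ht) as hsqt; pose proof (cosh_gt0 (u t / r)).
    pose proof (sqrt_lt_R0 _ hsqt).
    apply Rmult_integral_contrapositive_currified;
      [apply Rmult_integral_contrapositive_currified|].
    * exact hne.
    * apply Rgt_not_eq, Rdiv_lt_0_compat; assumption.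
    * unfold speed_sq, metric_sq in hsqt; intros h.
      assert (hp : Derive u t = 0) by nra; assert (hq : Derive v t = 0) by nra.
      rewrite hp, hq in hsqt; lra.
  + assert (hJcd : forall x, c <= x <= d -> J x)
      by (intros x hx; apply (hconv a b); [assumption..|lra]).
    assert (hUv : is_variation u 1 c d (fun s t => u t + s * (k * ((t - c) * (d - t)))))
      by (apply affine_is_variation; intros x hx; apply hu, hJcd, hx).
    assert (hVv : is_variation v 1 c d (fun s t => v t + s * (l * ((t - c) * (d - t)))))
      by (apply affine_is_variation; intros x hx; apply hv, hJcd, hx).
    (* Criticality makes the derivative of the energy 0 ([h1]), while [h2] computes it as the
       integral in [hI]. *)
    apply hI.
    pose proof (is_derive_unique _ _ _ (H c d (hJcd c ltac:(lra)) (hJcd d ltac:(lra)) hcd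
      1 _ _ Rlt_0_1 hUv hVv)) as h1.
    pose proof (is_derive_unique _ _ _ (energy_variation 1 c d _ _ Rlt_0_1 hcd hUv hVv
      (fun x hx => hu x (hJcd x hx)) (fun x hx => hv x (hJcd x hx))
      (fun x hx => hpos x (hJcd x hx)) (fun x hx => hsq x (hJcd x hx)))) as h2.
    rewrite <- h1, h2; apply RInt_ext; intros x _.
    assert (hD1 : forall (f : R -> R) m,
      D1 (fun s t => f t + s * (m * ((t - c) * (d - t)))) 0 x = m * ((x - c) * (d - x)))
      by (intros f m; apply is_derive_unique; auto_derive; [exact I|ring]).
    rewrite !hD1; apply Rminus_diag_uniq; unfold l, k; ring.
- intros a b ha hb hab eps U V heps hU hV.
  assert (hJab : forall x, a <= x <= b -> J x)
    by (intros x hx; exact (hconv a b x ha hb hx)).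
  evar_last.
  + apply (energy_variation eps); try assumption;
      intros x hx; first [apply hu|apply hv|apply hpos|apply hsq]; apply hJab, hx.
  + rewrite (RInt_ext _ (fun _ => 0)).
    * rewrite RInt_const; apply Rmult_0_r.
    * rewrite Rmin_left, Rmax_right by lra; intros x hx.
      unfold gradient; rewrite H, Rmult_0_l by (apply hJab; lra); apply Rmult_0_l.
Qed.

(** The equation [defect = 0] is linear in the curvature with coefficient speed times [W], positive
    on [J], and so can be solved for it. *)
Lemma extrinsic_catenary_iff_kappa :
  extrinsic_catenary ty r J u v <->
  forall t, J t -> kappa r u v t =
    (Wu (u t) (v t) * Derive v t * cosh (u t / r) -
     Wv (u t) (v t) * Derive u t / cosh (u t / r)) /
    (speed r u v t * W (u t) (v t)).
Proof.
rewrite extrinsic_catenary_iff_defect.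
assert (heq : forall t, J t -> 0 < speed r u v t /\
  defect_along W Wu Wv r u v t =
  kappa r u v t * speed r u v t * W (u t) (v t) -
  (Wu (u t) (v t) * Derive v t * cosh (u t / r) -
     Wv (u t) (v t) * Derive u t / cosh (u t / r))).
{ intros t ht; pose proof (regular_metric_sq r J u v t hreg ht) as hsq.
  rewrite speed_psi, kappa_psi by assumption.
  split; [apply sqrt_lt_R0, hsq|reflexivity]. }
split; intros H t ht; destruct (heq t ht) as [hs hd]; specialize (H t ht);
  specialize (hpos t ht).
- rewrite H in hd.
  replace (_ - _) with (kappa r u v t * speed r u v t * W (u t) (v t)) by lra.
  field; lra.
- rewrite hd, H; pose proof (cosh_gt0 (u t / r)); field; lra.
Qed.

End Critical.

(** * The three weights *)

Lemma dist_plane_partials (r : R) (hr : 0 < r) :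
  C1_with_partials (fun x _ => r * sinh (x / r) * 1) (fun x _ => cosh (x / r) * 1)
    (fun x _ => r * sinh (x / r) * 0) /\
  C1_with_partials (fun x y => r * cosh (x / r) * cosh (y / r))
    (fun x y => sinh (x / r) * cosh (y / r))
    (fun x y => r * cosh (x / r) * (sinh (y / r) / r)) /\
  C1_with_partials (fun x y => r * cosh (x / r) * exp (- y / r))
    (fun x y => sinh (x / r) * exp (- y / r))
    (fun x y => r * cosh (x / r) * (- exp (- y / r) / r)).
Proof.
assert (hc : forall x, continuous (fun y => cosh (y / r)) x)
  by (intros x; apply continuous_cosh_div; [exact hr|apply continuous_id]).
assert (hs : forall x, continuous (fun y => sinh (y / r)) x)
  by (intros x; apply continuous_sinh_div; [exact hr|apply continuous_id]).
assert (hdc : forall x, is_derive (fun y => r * cosh (y / r)) x (sinh (x / r)))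
  by (intros x; replace (sinh (x / r)) with (r * (sinh (x / r) / r)) by (field; lra);
      apply is_derive_scal, is_derive_cosh_div, hr).
assert (hds : forall x, is_derive (fun y => r * sinh (y / r)) x (cosh (x / r)))
  by (intros x; replace (cosh (x / r)) with (r * (cosh (x / r) / r)) by (field; lra);
      apply is_derive_scal, is_derive_sinh_div, hr).
split; [|split].
(* The elliptic weight is a product with the constant 1, whence the factors [* 1] and [* 0]. *)
- apply (C1_with_partials_prod (fun x => r * sinh (x / r)) (fun x => cosh (x / r))
    (fun _ => 1) (fun _ => 0)); try assumption.
  + intros y; apply @is_derive_const.
  + intros y; apply continuous_const.
- apply (C1_with_partials_prod (fun x => r * cosh (x / r)) (fun x => sinh (x / r))
    (fun y => cosh (y / r)) (fun y => sinh (y / r) / r)); try assumption.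
  + intros y; apply is_derive_cosh_div, hr.
  + intros y; specialize (hs y); continuity_arith; lra.
- apply (C1_with_partials_prod (fun x => r * cosh (x / r)) (fun x => sinh (x / r))
    (fun y => exp (- y / r)) (fun y => - exp (- y / r) / r)); try assumption.
  + intros y; auto_derive; [lra|unfold Rdiv; ring].
  + intros y; apply (ex_derive_continuous (fun y => - exp (- y / r) / r)).
    auto_derive; repeat split; lra.
Qed.

Lemma forall_eq_rhs (J : R -> Prop) (f h k : R -> R) :
  (forall t, J t -> h t = k t) ->
  ((forall t, J t -> f t = h t) <-> (forall t, J t -> f t = k t)).
Proof.
intros heq; split; intros H t ht; rewrite H by exact ht;
  [|symmetry]; apply heq, ht.
Qed.

Theorem theorem3 (r : R) (J : R -> Prop) (u v : R -> R)
    (hr : 0 < r) (hJ : is_interval J)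
    (hu : smooth_on J u) (hv : smooth_on J v) (hreg : regular_on J u v) :
  ((forall t, J t -> 0 < u t) ->
   (extrinsic_catenary Elliptic r J u v <->
    forall t, J t ->
      kappa r u v t =
        Derive v t * cosh (u t / r) ^ 2
          / (r * sinh (u t / r) * speed r u v t))) /\
  (extrinsic_catenary Hyperbolic r J u v <->
   forall t, J t ->
     kappa r u v t =
       1 / (r * speed r u v t) *
         (- (Derive u t * sinh (v t / r) / (cosh (u t / r) * cosh (v t / r)))
          + Derive v t * sinh (u t / r))) /\
  (extrinsic_catenary Parabolic r J u v <->
   forall t, J t ->
     kappa r u v t =
       1 / (r * speed r u v t) *
         (Derive u t / cosh (u t / r) + Derive v t * sinh (u t / r))).
Proof.
destruct (dist_plane_partials r hr) as (hE & hH & hP).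
assert (hspeed : forall t, J t -> 0 < speed r u v t)
  by (intros t ht; rewrite speed_psi by exact hr;
      exact (sqrt_lt_R0 _ (regular_metric_sq r J u v t hreg ht))).
split; [|split].
- intros hupos.
  assert (hsinh : forall t, J t -> 0 < sinh (u t / r)).
  { intros t ht; rewrite <- sinh_0; apply sinh_lt.
    apply Rdiv_lt_0_compat; [apply hupos, ht|exact hr]. }
  etransitivity;
    [apply (extrinsic_catenary_iff_kappa Elliptic _ _ _ r u v hr hE); try assumption|].
  + intros x y hpos; destruct (dist_plane_psi r x y hr) as (-> & _ & _).
    (* Positivity of the weight at [(x, y)] removes the absolute value from the distance. *)
    rewrite Rabs_pos_eq; [ring|].
    apply Rlt_le, (Rmult_lt_reg_l r); lra.
  + intros t ht; pose proof (Rmult_lt_0_compat _ _ hr (hsinh t ht)); lra.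
  (* Here [W_v = 0], and only the term in [Derive v t] survives. *)
  + apply forall_eq_rhs; intros t ht; cbv beta.
    pose proof (hspeed t ht); pose proof (hsinh t ht); pose proof (cosh_gt0 (u t / r)).
    field; lra.
- etransitivity;
    [apply (extrinsic_catenary_iff_kappa Hyperbolic _ _ _ r u v hr hH); try assumption|].
  + intros x y _; destruct (dist_plane_psi r x y hr) as (_ & -> & _); ring.
  + intros t _; apply Rmult_lt_0_compat; [apply Rmult_lt_0_compat|];
      [exact hr|apply cosh_gt0..].
  (* The logarithmic derivatives are [W_u / W = sinh (u / r) / (r * cosh (u / r))] and the same in
     [v]. *)
  + apply forall_eq_rhs; intros t ht; cbv beta.
    pose proof (hspeed t ht); pose proof (cosh_gt0 (u t / r)); pose proof (cosh_gt0 (v t / r)).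
    field; lra.
- etransitivity;
    [apply (extrinsic_catenary_iff_kappa Parabolic _ _ _ r u v hr hP); try assumption|].
  + intros x y _; destruct (dist_plane_psi r x y hr) as (_ & _ & ->); ring.
  + intros t _; apply Rmult_lt_0_compat; [apply Rmult_lt_0_compat|];
      [exact hr|apply cosh_gt0|apply exp_pos].
  (* [W_v / W = - 1 / r]: the exponential cancels and the first term gets a plus sign. *)
  + apply forall_eq_rhs; intros t ht; cbv beta.
    pose proof (hspeed t ht); pose proof (cosh_gt0 (u t / r)); pose proof (exp_pos (- v t / r)).
    field; lra.
Qed.
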